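(* For any infinite cardinal $\lambda$ and any positive integer $n$, the semigroup $\mathscr{I}_\lambda^n$ is algebraically closed in the class of topological inverse semigroups.
   Context: All topological spaces are assumed Hausdorff. A topological semigroup is a semigroup with a Hausdorff topology for which multiplication is (jointly) continuous. An inverse semigroup is a semigroup in which each element $x$ has a unique inverse $x'$ (with $xx'x=x$, $x'xx'=x'$); a topological inverse semigroup is an inverse semigroup that is a topological semigroup with continuous inversion $x\mapsto x'$. Let $\mathfrak{S}$ be a class of topological semigroups. A topological semigroup $S\in\mathfrak{S}$ is $H$-closed in the class $\mathfrak{S}$ if $S$ is a closed subsemigroup of any topological semigroup $T\in\mathfrak{S}$ which contains $S$ as a subsemigroup (with $S$ carrying the subspace topology). A semigroup $S$ is algebraically closed in the class $\mathfrak{S}$ if for any topology $\tau$ on $S$ such that $(S,\tau)\in\mathfrak{S}$, the topological semigroup $(S,\tau)$ is $H$-closed in the class $\mathfrak{S}$. For a cardinal $\lambda$, $\mathscr{I}_\lambda$ denotes the symmetric inverse semigroup on the set $\lambda$: all one-to-one functions with domain and range subsets of $\lambda$ (including the empty transformation $0$), under composition $ab(x)=a(b(x))$ wherever defined. The rank of a transformation is the cardinality of its domain, and $\mathscr{I}_\lambda^n$ is the ideal of $\mathscr{I}_\lambda$ consisting of the transformations of rank at most $n$. *)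

(* Defs.v *)
From HB Require Import structures.
From mathcomp Require Import all_boot.
From mathcomp Require Import boolp classical_sets functions cardinality.
From mathcomp Require Import topology.

Set Implicit Arguments.
Unset Strict Implicit.
Unset Printing Implicit Defensive.

Local Open Scope classical_set_scope.
Local Open Scope group_scope.
Local Open Scope card_scope.

(* Topologies are passed unbundled, so that one can quantify over all the
   topologies on a fixed semigroup. The class record also carries an eqType and
   a choiceType structure on S; these are irrelevant to the topology. *)
Definition topology_on (S : Type) : Type := Topological.axioms_ S.

Definition topologized (S : Type) (tau : topology_on S) : topologicalType :=
  Topological.Pack tau.

(* The Hausdorff axiom is part of the definition of a topological semigroup. *)
Definition topological_semigroup (S : semigroupType) (tau : topology_on S) :
    Prop :=
  let X := topologized tau in
  hausdorff_space X /\
  continuous ((fun p : X * X => ((p.1 : S) * (p.2 : S) : S)) : X * X -> X).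

Definition inverse_of (S : semigroupType) (x y : S) : Prop :=
  x * y * x = x /\ y * x * y = y.

Definition inverse_semigroup (S : semigroupType) : Prop :=
  forall x : S, exists! y : S, inverse_of x y.

Definition topological_inverse_semigroup (S : semigroupType)
    (tau : topology_on S) : Prop :=
  let X := topologized tau in
  [/\ inverse_semigroup S,
      topological_semigroup tau &
      exists2 inv : S -> S,
        (forall x, inverse_of x (inv x)) & continuous (inv : X -> X)].

Definition semigroup_class : Type :=
  forall S : semigroupType, topology_on S -> Prop.

(* f identifies (S, sigma) with a subsemigroup of (T, tau) that carries the
   subspace topology. *)
Definition topological_semigroup_embedding (S T : semigroupType)
    (sigma : topology_on S) (tau : topology_on T) (f : S -> T) : Prop :=
  [/\ injective f,
      {morph f : x y / x * y} &
      forall U : set S,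
        @open (topologized sigma) U <->
        exists2 V : set T, @open (topologized tau) V & U = f @^-1` V].

Definition H_closed_in (C : semigroup_class) (S : semigroupType)
    (sigma : topology_on S) : Prop :=
  C S sigma /\
  forall (T : semigroupType) (tau : topology_on T) (f : S -> T),
    C T tau -> topological_semigroup_embedding sigma tau f ->
    @closed (topologized tau) (range f).

Definition algebraically_closed_in (C : semigroup_class) (S : semigroupType) :
    Prop :=
  forall tau : topology_on S, C S tau -> H_closed_in C tau.

(* a x = None means that x is outside of the domain of a. *)
Record sym_inv (L : Type) : Type := SymInv {
  sym_inv_fun :> L -> option L;
  sym_inv_inj : forall x y z : L,
    sym_inv_fun x = Some z -> sym_inv_fun y = Some z -> x = y
}.

Section SymmetricInverseSemigroup.
Variable L : Type.
Implicit Types a b c : sym_inv L.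

Lemma sym_inv_eq a b : (forall x, a x = b x) -> a = b.
Proof.
case: a b => [f fi] [g gi] /= fg.
have e : f = g by apply/funext.
by subst g; congr SymInv; apply: Prop_irrelevance.
Qed.

Lemma sym_inv_mul_inj a b x y z :
  pcomp a b x = Some z -> pcomp a b y = Some z -> x = y.
Proof.
rewrite /pcomp; case bx : (b x) => [u|] //=; case bY : (b y) => [v|] //= au av.
by move: bY; rewrite -(sym_inv_inj au av); apply: sym_inv_inj.
Qed.

Definition sym_inv_mul a b : sym_inv L := SymInv (@sym_inv_mul_inj a b).

Lemma sym_inv_mulA : associative sym_inv_mul.
Proof.
move=> a b c; apply: sym_inv_eq => x /=.
by rewrite /pcomp /=; case: (c x).
Qed.

HB.instance Definition _ := gen_eqMixin (sym_inv L).
HB.instance Definition _ := gen_choiceMixin (sym_inv L).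
HB.instance Definition _ := isSemigroup.Build (sym_inv L) sym_inv_mulA.

Definition sym_inv_dom a : set L := [set x | a x <> None].

Definition rank_at_most (n : nat) : set (sym_inv L) :=
  [set a | sym_inv_dom a #<= `I_n].

Lemma rank_at_mostM n a b : rank_at_most n b -> rank_at_most n (a * b).
Proof.
apply: card_le_trans; apply: subset_card_le => x.
by rewrite /sym_inv_dom /= /pcomp; case: (b x).
Qed.

Definition sym_inv_rank (n : nat) : Type := set_type (rank_at_most n).

HB.instance Definition _ n := Choice.on (sym_inv_rank n).

Lemma sym_inv_rank_mul_subproof n (a b : sym_inv_rank n) :
  val a * val b \in rank_at_most n.
Proof. by apply/mem_set/rank_at_mostM/set_mem/valP. Qed.

Definition sym_inv_rank_mul n (a b : sym_inv_rank n) : sym_inv_rank n :=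
  exist _ (val a * val b) (sym_inv_rank_mul_subproof a b).

Lemma sym_inv_rank_mulA n : associative (@sym_inv_rank_mul n).
Proof. by move=> a b c; apply: val_inj; rewrite /= mulgA. Qed.

HB.instance Definition _ n :=
  isSemigroup.Build (sym_inv_rank n) (@sym_inv_rank_mulA n).

End SymmetricInverseSemigroup.

(* Main.v *)
(** Idea. Let [S = I_L^n] sit inside a topological inverse semigroup [T]. Two
    finiteness properties of [S] are enough: every set [a S b] is finite, and
    the idempotents (partial identities, ordered by inclusion of domains)
    satisfy the ascending chain condition.
    - The idempotents [E] of [S] are closed in [T]. If [e] is a limit of [E]
      and [b] is in [E], then [b e] is a limit of the finite set [b E], so it
      lies in [E]. Hence [e E] is a subset of [E] in which [e] acts as an
      identity; elements of [E] close to [e] show that [e E] is directed, so it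
      has a greatest element, and this element must be [e].
    - If [x] is a limit of [S], then [x x'] and [x' x] are limits of [E], so
      they lie in [E], and [x = (x x') x (x' x)] is a limit of the finite set
      [(x x') S (x' x)], so it lies in [S]. *)
Require Import Defs.
From mathcomp Require Import all_boot.
From mathcomp Require Import finmap.
From mathcomp Require Import boolp classical_sets functions cardinality.
From mathcomp Require Import topology.

Set Implicit Arguments.
Unset Strict Implicit.
Unset Printing Implicit Defensive.

Local Open Scope classical_set_scope.

(** * Limits and continuous maps into Hausdorff spaces *)

Lemma closure_image_continuous (X Y : topologicalType) (h : X -> Y) (A : set X)
    (x : X) : continuous h -> closure A x -> closure (h @` A) (h x).
Proof.
move=> hc Ax B /hc hB; have [y [Ay By]] := Ax _ hB.
by exists (h y); split => //; exists y.
Qed.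

(** Finite subsets of a Hausdorff space are closed, so a finite image already contains its
    limits. *)
Lemma closure_image_finite (X Y : topologicalType) (h : X -> Y) (A : set X)
    (x : X) : hausdorff_space Y -> continuous h -> finite_set (h @` A) ->
  closure A x -> (h @` A) (h x).
Proof.
move=> /hausdorff_accessible/accessible_finite_set_closed cl hc /cl hA Ax.
exact/hA/closure_image_continuous.
Qed.

Lemma closed_equalizer (X Y : topologicalType) (g h : X -> Y) :
  hausdorff_space Y -> continuous g -> continuous h ->
  closed [set x | g x = h x].
Proof.
move=> Y_T2 gc hc x clx; apply: Y_T2 => A B nA nB.
have gA : nbhs x (g @^-1` A) by exact: gc.
have hB : nbhs x (h @^-1` B) by exact: hc.
have [y [/= gh [Ay By]]] := clx _ (filterI gA hB).
by exists (g y); split => //; rewrite gh.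
Qed.

(** * Closedness criteria inside a topological semigroup *)

Section ClosedSubsemigroups.
Variables (X : topologicalType) (mul : X -> X -> X).
Hypotheses (X_T2 : hausdorff_space X) (mulA : associative mul)
  (mul_continuous : continuous (fun p : X * X => mul p.1 p.2)).

Lemma continuous_mul (Y : topologicalType) (g h : Y -> X) :
  continuous g -> continuous h -> continuous (fun y => mul (g y) (h y)).
Proof.
move=> gc hc y.
apply: (@continuous_comp _ _ _ (fun y => (g y, h y)) (fun p => mul p.1 p.2)).
  by apply: cvg_pair; [exact: gc|exact: hc].
exact: mul_continuous.
Qed.

Lemma continuous_mull a : continuous (mul a).
Proof. by apply: continuous_mul => y; [exact: cvg_cst|exact: cvg_id]. Qed.

Lemma continuous_mulr a : continuous (mul ^~ a).
Proof. by apply: continuous_mul => y; [exact: cvg_id|exact: cvg_cst]. Qed.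

(** In the semilattice order, [mul b c = b] means that [b] lies below [c]; the last hypothesis thus
    gives maximal elements. *)
Lemma semilattice_closed (E : set X) :
  (forall a b, E a -> E b -> E (mul a b)) ->
  (forall a, E a -> mul a a = a) ->
  (forall a b, E a -> E b -> mul a b = mul b a) ->
  (forall a, E a -> finite_set (mul a @` E)) ->
  (forall D, D `<=` E -> D !=set0 ->
     exists2 b, D b & forall c, D c -> mul b c = b -> c = b) ->
  closed E.
Proof.
move=> EM Eid EC Efin Eacc e clE.
have ee : mul e e = e.
  apply: (@closed_equalizer X X (fun x => mul x x) id) => //.
  - by apply: continuous_mul => y; exact: cvg_id.
  - by move=> y; exact: cvg_id.
  - exact: (closureS _ clE).
have eC b : E b -> mul b e = mul e b.
  move=> Eb; apply: (closed_equalizer X_T2 (@continuous_mull b)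
    (@continuous_mulr b)).
  by apply: closureS clE => a Ea /=; exact: EC.
have Ee b : E b -> E (mul b e).
  move=> Eb.
  have [a Ea <-] := closure_image_finite X_T2 (@continuous_mull b) (Efin _ Eb) clE.
  exact: EM.
(* If [b] is below [e], the closed finite set [F] misses [mul b e = b], so elements of [E] near [e]
   lie above [b]. *)
have nbE b : E b -> mul b e = b -> nbhs e [set x | E x -> mul b x = b].
  move=> Eb be.
  have /accessible_finite_set_closed cl := hausdorff_accessible X_T2.
  pose F := (mul b @` E) `\ b.
  have Fe : nbhs (mul b e) (~` F).
    apply: open_nbhs_nbhs; split; last by rewrite be => -[_]; exact.
    by rewrite openC; apply: cl; apply: finite_setD; exact: Efin.
  have nF : nbhs e (mul b @^-1` ~` F) by exact: continuous_mull.
  apply: filterS nF => x /= Fx Ex.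
  by apply: contrapT => bx; apply: Fx; split => //; exists x.
pose D := E `&` [set b | mul b e = b].
have De a : E a -> D (mul a e).
  by move=> Ea; split; [exact: Ee|rewrite /= -mulA ee].
have [a0 [Ea0 _]] := clE _ filterT.
have [b [Eb be] bmax] := Eacc D (@subIsetl _ _ _) (ex_intro _ _ (De _ Ea0)).
(* A maximal [b] is greatest: some [a] in [E] near [e] is above both [b] and [c], so [mul a e] is in
   [D] above [b], hence equal to [b], and it is still above [c]. *)
have Dub c : D c -> mul c b = c.
  move=> [Ec ce].
  have [a [Ea [/= /(_ Ea) ba /(_ Ea) ca]]] :=
    clE _ (filterI (nbE _ Eb be) (nbE _ Ec ce)).
  rewrite -{1}(bmax _ (De _ Ea)); first by rewrite mulA ca ce.
  by rewrite mulA ba be.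
(* The identity [x e b = x e] holds on [E] because [x e] is in [D]; it passes to the limit
   [x = e]. *)
have eb : mul e b = e.
  rewrite -[in LHS]ee -[RHS]ee.
  apply: (@closed_equalizer X X (fun x => mul (mul x e) b) (mul ^~ e)) => //.
  - by apply: continuous_mul; [exact: continuous_mulr|move=> y; exact: cvg_cst].
  - exact: continuous_mulr.
  - by apply: closureS clE => a /De/Dub.
by rewrite -eb -eC // be.
Qed.

Lemma inverse_subsemigroup_closed (S : set X) (inv : X -> X) :
  continuous inv -> (forall x, mul (mul x (inv x)) x = x) ->
  (forall a b, S a -> S b -> S (mul a b)) -> (forall a, S a -> S (inv a)) ->
  (forall a b, S a -> S b -> finite_set ((fun s => mul (mul a s) b) @` S)) ->
  closed (S `&` [set a | mul a a = a]) ->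
  closed S.
Proof.
move=> invc invK SM SV Sfin clE x clS.
have idc : continuous (@id X) by move=> y; exact: cvg_id.
have [Sxx' _] : (S `&` [set a | mul a a = a]) (mul x (inv x)).
  apply: clE; apply: closureS
    (closure_image_continuous (continuous_mul idc invc) clS).
  by move=> _ [a Sa <-]; split; [exact/SM/SV|rewrite /= mulA invK].
have clS' : closure S (inv x).
  apply: closureS (closure_image_continuous invc clS) => _ [a Sa <-].
  exact: SV.
have [Sx'x _] : (S `&` [set a | mul a a = a]) (mul (inv x) x).
  apply: clE; apply: closureS
    (closure_image_continuous (continuous_mul invc idc) clS).
  move=> _ [a Sa <-]; split; first exact/SM/Sa/SV.
  by rewrite /= -mulA (mulA a) invK.
have hc : continuous (fun s => mul (mul (mul x (inv x)) s) (mul (inv x) x)).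
  by apply: continuous_mul; [exact: continuous_mull|move=> y; exact: cvg_cst].
have [s Ss] := closure_image_finite X_T2 hc (Sfin _ _ Sxx' Sx'x) clS.
by rewrite invK (mulA x) invK => <-; apply/SM => //; exact/SM.
Qed.

End ClosedSubsemigroups.

(** * From algebraic finiteness conditions to algebraic closedness *)

Local Open Scope group_scope.

Lemma algebraically_closed_of_finite_sandwich (S : semigroupType) :
  (forall a b : S, finite_set (range (fun s => a * s * b))) ->
  (forall a b : S, a * a = a -> b * b = b -> a * b = b * a) ->
  (forall D : set S, D `<=` [set a | a * a = a] -> D !=set0 ->
     exists2 b, D b & forall c, D c -> b * c = b -> c = b) ->
  algebraically_closed_in (@topological_inverse_semigroup) S.
Proof.
move=> Sfin SC Sacc sigma CS; split => // T tau f [invT [T2 Tc] [inv invP invc]].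
move=> [f_inj fM _]; case: CS => invS _ _.
have fE a : f a * f a = f a -> a * a = a.
  by rewrite -fM => /f_inj.
apply: (@inverse_subsemigroup_closed (topologized tau)
  (fun x y : T => (x : T) * y) T2 (@mulgA T) Tc (range f) inv) => //.
- by move=> x; case: (invP x).
- by move=> _ _ [a _ <-] [b _ <-]; exists (a * b).
(* Inverses in [T] are unique, so [inv (f a)] is the image of the inverse of [a] in [S]. *)
- move=> _ [a _ <-]; have [a' [[aa' a'a] _]] := invS a.
  have [y [_ y_uniq]] := invT (f a).
  exists a' => //; rewrite -(y_uniq _ (invP _)); apply/esym/y_uniq.
  by split; rewrite -!fM ?aa' ?a'a.
- move=> _ _ [a _ <-] [b _ <-].
  apply: sub_finite_set (finite_image f (Sfin a b)).
  by move=> _ [_ [s _ <-] <-]; exists (a * s * b); [exists s|rewrite !fM].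
apply: (@semilattice_closed (topologized tau)
  (fun x y : T => (x : T) * y) T2 (@mulgA T) Tc).
- move=> _ _ [[a _ <-] /fE aa] [[b _ <-] /fE bb]; split; first by exists (a * b).
  by rewrite /= -!fM mulgA -(mulgA a) -(SC a b) // mulgA aa -mulgA bb.
- by move=> a [].
- by move=> _ _ [[a _ <-] /fE aa] [[b _ <-] /fE bb]; rewrite -!fM SC.
(* For commuting idempotents [a * b = a * b * a], so these products lie in the image of the finite
   set [a S a]. *)
- move=> _ [[a _ <-] /fE aa]; apply: sub_finite_set (finite_image f (Sfin a a)).
  move=> _ [_ [[b _ <-] /fE bb] <-]; exists (a * b * a); first by exists b.
  by rewrite -mulgA (SC b a) // mulgA aa fM.
move=> D DE [_ /[dup] /DE[[a _ <-] _] Da].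
have [||b Db bmax] := Sacc (f @^-1` D); first by move=> c /DE[_ /fE].
  by exists a.
exists (f b) => // _ /[dup] /DE[[c _ <-] _] Dc; rewrite -fM => /f_inj.
by move=> /bmax ->.
Qed.

Lemma finite_set_subsets (T : Type) (A : set T) :
  finite_set A -> finite_set [set B | B `<=` A].
Proof.
(* [{classic T}] supplies the choice structure needed for finite powersets. *)
move=> finA; pose A' : set {classic T} := A.
apply: sub_finite_set (finite_image (fun F : {fset {classic T}} => [set` F])
  (finite_fset (fpowerset (fset_set A')))).
move=> B BA; have finB := sub_finite_set BA finA.
exists (fset_set (B : set {classic T})); last exact: fset_setK.
by rewrite /= fpowersetE -fset_set_sub.
Qed.

(** * Idempotents and finiteness in the symmetric inverse semigroup *)

Section PartialBijections.
Variable L : Type.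
Implicit Types a b c s : sym_inv L.

Lemma sym_inv_mulE a b x : (a * b) x = obind a (b x).
Proof. by rewrite /= /pcomp. Qed.

(** Idempotents are partial identities: [a] sends both [x] and [y] to [y], and it is injective. *)
Lemma sym_inv_idem a x y : a * a = a -> a x = Some y -> x = y.
Proof.
move=> aa ax; have := sym_inv_mulE a a x.
by rewrite aa ax /= => /esym /(sym_inv_inj ax).
Qed.

Lemma sym_inv_idemC a b : a * a = a -> b * b = b -> a * b = b * a.
Proof.
move=> aa bb; apply: sym_inv_eq => x; rewrite !sym_inv_mulE.
case ax : (a x) => [y|]; case bx : (b x) => [z|] //=.
- by rewrite -(sym_inv_idem aa ax) -(sym_inv_idem bb bx) ax bx
    -(sym_inv_idem aa ax) -(sym_inv_idem bb bx).
- by rewrite -(sym_inv_idem aa ax) bx.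
- by rewrite -(sym_inv_idem bb bx) ax.
Qed.

Lemma sym_inv_dom_sub a b :
  a * b = a -> sym_inv_dom a `<=` sym_inv_dom b.
Proof.
by move=> ab x; rewrite /sym_inv_dom /= -[in X in X -> _]ab sym_inv_mulE;
  case: (b x).
Qed.

Lemma sym_inv_idem_dom_inj a b : a * a = a -> b * b = b ->
  sym_inv_dom a = sym_inv_dom b -> a = b.
Proof.
move=> aa bb dab; apply: sym_inv_eq => x.
have := congr1 (fun A : set L => A x) dab; rewrite /sym_inv_dom /=.
case ax : (a x) => [y|]; case bx : (b x) => [z|] //.
- by rewrite -(sym_inv_idem aa ax) -(sym_inv_idem bb bx).
- by move=> e; have : None <> None :> option L by rewrite -e.
- by move=> e; have : None <> None :> option L by rewrite e.
Qed.

Definition sym_inv_graph a : set (L * L) := [set p | a p.1 = Some p.2].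

Lemma sym_inv_graph_inj : injective sym_inv_graph.
Proof.
move=> a b ab; apply: sym_inv_eq => x.
have abx y : (a x = Some y) = (b x = Some y).
  exact: (congr1 (fun A : set (L * L) => A (x, y)) ab).
case ax : (a x) => [y|]; first by move: ax; rewrite abx => ->.
by case bx : (b x) => [y|] //; move: bx; rewrite -abx ax.
Qed.

(** Every [a * s * b] is determined by its graph, a subset of the finite product of the domain of
    [b] and the range of [a]. *)
Lemma finite_sandwich a b :
  finite_set (sym_inv_dom a) -> finite_set (sym_inv_dom b) ->
  finite_set (range (fun s => a * s * b)).
Proof.
move=> fina finb.
pose ran := Some @^-1` (a @` sym_inv_dom a).
have finran : finite_set ran.
  by apply: finite_preimage; [move=> x y _ _ []|exact: finite_image].
have finG := finite_set_subsets (finite_setX finb finran).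
apply: sub_finite_set (finite_preimage (in2W sym_inv_graph_inj) finG).
move=> _ [s _ <-] [x y] asb.
have {asb} : (a * s * b) x = Some y by [].
rewrite sym_inv_mulE; case bx : (b x) => [z|] //; rewrite [obind _ _]sym_inv_mulE.
case: (s z) => //= w aw; split; first by rewrite /sym_inv_dom /= bx.
by exists w => //; rewrite /sym_inv_dom /= aw.
Qed.

End PartialBijections.

(** * Transformations of bounded rank *)

Section FiniteRank.
Variables (L : Type) (n : nat).
Implicit Types a b c : sym_inv_rank L n.

Lemma sym_inv_rank_dom_finite a : finite_set (sym_inv_dom (val a)).
Proof. by apply/finite_set_leP; exists n; exact: (set_mem (valP a)). Qed.

(** Ranks are bounded by [n], so [D] has an element [b] of maximal rank. Any [c] in [D] above [b]
    has a larger or equal domain, hence the same one, and an idempotent is determined by its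
    domain. *)
Lemma sym_inv_rank_acc (D : set (sym_inv_rank L n)) :
  D `<=` [set a | a * a = a] -> D !=set0 ->
  exists2 b, D b & forall c, D c -> b * c = b -> c = b.
Proof.
move=> Did [a0 Da0].
pose dom a : set {classic L} := sym_inv_dom (val a).
have domfin a : finite_set (dom a) := sym_inv_rank_dom_finite a.
pose r a := #|` fset_set (dom a)|.
have exP : exists m, `[< exists2 a, D a & r a = m >].
  by exists (r a0); apply/asboolP; exists a0.
have ubP m : `[< exists2 a, D a & r a = m >] -> m <= n.
  move=> /asboolP[a _ <-]; apply: geq_card_fset_set.
  exact: (set_mem (valP a)).
case: (ex_maxnP exP ubP) => m /asboolP[b Db <-] bmax.
exists b => // c Dc bc; apply: val_inj.
have Dval a : D a -> val a * val a = val a by move=> /Did/(congr1 val).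
suff : dom c = dom b by exact: sym_inv_idem_dom_inj (Dval _ Dc) (Dval _ Db).
have bc_sub : dom b `<=` dom c.
  exact: sym_inv_dom_sub (congr1 val bc).
have rcb : r c <= r b by apply: bmax; apply/asboolP; exists c.
apply: fset_set_inj => //; apply/esym/eqP.
move: bc_sub; rewrite fset_set_sub // => bc_sub.
apply: contraTT rcb => ne; rewrite -ltnNge; apply: fproper_ltn_card.
by rewrite fproperEneq ne.
Qed.

End FiniteRank.

Theorem corollary14 (L : Type) (n : nat) (L_infinite : infinite_set [set: L])
    (n_gt0 : (0 < n)%N) :
  algebraically_closed_in (@topological_inverse_semigroup) (sym_inv_rank L n).
Proof.
apply: algebraically_closed_of_finite_sandwich.
(* [val] embeds this set into the corresponding one for the full symmetric inverse semigroup. *)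
- move=> a b; apply: sub_finite_set (finite_preimage (in2W val_inj)
    (finite_sandwich (sym_inv_rank_dom_finite a) (sym_inv_rank_dom_finite b))).
  by move=> _ [s _ <-]; exists (val s).
- move=> a b aa bb; apply: val_inj.
  exact: sym_inv_idemC (congr1 val aa) (congr1 val bb).
- exact: sym_inv_rank_acc.
Qed.
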